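(* Let $\mathcal{L}=\{L_1,\ldots,L_r\}\subset S_1$ be a generally linear set, where $L_i=a_0(i)x_0+\cdots+a_n(i)x_n$ for $i=1,\ldots,r$. Then $\mathcal{L}$ is a strong Hadamard set if and only if both of the following hold: (1) $a_j(i)\neq 0$ for all $1\le i\le r$ and $0\le j\le n$; and (2) there exists a vector $\mathbf{a}\in\mathbb{C}^{n+1}$ with no zero coordinates such that $M\mathbf{a}=\mathbf{0}$, where $M$ is the $r\times(n+1)$ matrix (well defined when (1) holds) $$M=\begin{pmatrix}\frac{1}{a_0(1)} & \cdots & \frac{1}{a_n(1)}\\ \vdots & & \vdots\\ \frac{1}{a_0(r)} & \cdots & \frac{1}{a_n(r)}\end{pmatrix}.$$ Moreover, if $n=2$ (and (1) holds, so that $M$ is defined), condition (2) is equivalent to the condition $\mathrm{rk}(M)\leq 2$.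
   Context: Let $n\ge 1$, $S=\mathbb{C}[x_0,\ldots,x_n]$, and let $S_1$ be the space of homogeneous linear forms in $S$. For a nonzero $F\in S_1$, $[F]$ denotes its class in the projective space $\mathbb{P}S_1$. A set $\mathcal{L}=\{L_1,\ldots,L_r\}\subset S_1$ of $r$ linear forms is generally linear if $r\ge n+1$ and any $n+1$ distinct elements of $\mathcal{L}$ are linearly independent. $\Delta_{n-1}\subset\mathbb{P}^n$ is the set of points having at least one zero coordinate; so $P\in\mathbb{P}^n\setminus\Delta_{n-1}$ means that all coordinates of $P$ are nonzero. A set $\mathcal{L}=\{L_1,\ldots,L_r\}\subset S_1$ is a Hadamard set if there exist $L=a_0x_0+\cdots+a_nx_n\in S_1$ and points $P_1,\ldots,P_r\in\mathbb{P}^n\setminus\Delta_{n-1}$, $P_i=[p_0(i):\cdots:p_n(i)]$, such that $$[L_i]=\left[\frac{a_0}{p_0(i)}x_0+\cdots+\frac{a_n}{p_n(i)}x_n\right]\in\mathbb{P}S_1\quad\text{for all } i.$$ It is a strong Hadamard set if $L$ and $P_1,\ldots,P_r$ can be chosen so that in addition $\sum_{j=0}^n a_jp_j(i)=0$ for $i=1,\ldots,r$. *)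

(* Defs.v *)
From mathcomp Require Import all_boot all_order all_algebra.
From mathcomp Require Import reals complex.
From mathcomp Require Export mpoly.

Set Implicit Arguments.
Unset Strict Implicit.
Unset Printing Implicit Defensive.

Import GRing.Theory.
Local Open Scope ring_scope.

Section ProjectiveSpace.
Variables (K : fieldType) (V : vectType K).

(* A point of the projective space of V is a line of V. *)
Record proj_space := ProjPoint {
  line_of :> {vspace V};
  _ : \dim line_of == 1%N }.

(* Q = [v]; only a nonzero vector has a class. *)
Definition is_class (Q : proj_space) (v : V) : Prop :=
  v != 0 /\ line_of Q = <[v]>%VS.

(* [u] = [v], both classes being defined. *)
Definition same_class (u v : V) : Prop :=
  exists Q : proj_space, is_class Q u /\ is_class Q v.

End ProjectiveSpace.

(* The homogeneous polynomials of degree 1 in the n + 1 variables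
   'X_0, ..., 'X_n. *)
Notation linear_forms K n := (dhomog n.+1 K 1).

Section HadamardSets.
Variables (K : fieldType) (n : nat).

Local Notation linear_forms := (linear_forms K n).

Lemma lform_subproof (a : 'rV[K]_n.+1) :
  \sum_(j < n.+1) a 0 j *: ('X_j : {mpoly K[n.+1]}) \is 1.-homog.
Proof. by apply: rpred_sum => j _; rewrite rpredZ // dhomogX /= mdeg1. Qed.

Definition lform (a : 'rV[K]_n.+1) : linear_forms := DHomog (lform_subproof a).

Definition generally_linear r (Ls : r.-tuple linear_forms) : Prop :=
  (n.+1 <= r)%N /\
  forall F : n.+1.-tuple linear_forms, uniq F -> {subset F <= Ls} -> free F.

Definition pn := proj_space 'rV[K]_n.+1.

(* The points of P^n with at least one zero coordinate. *)
Definition coord_hyperplanes (P : pn) : Prop :=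
  exists p : 'rV[K]_n.+1, is_class P p /\ exists j, p 0 j = 0.

(* a lists the coefficients of L, and p i is a choice of homogeneous
   coordinates of the point P i. *)
Definition hadamard_data r (Ls : r.-tuple linear_forms) (a : 'rV[K]_n.+1)
    (P : 'I_r -> pn) (p : 'I_r -> 'rV[K]_n.+1) : Prop :=
  forall i, [/\ ~ coord_hyperplanes (P i),
                is_class (P i) (p i) &
                same_class (tnth Ls i) (lform (\row_j (a 0 j / p i 0 j)))].

Definition hadamard_set r (Ls : r.-tuple linear_forms) : Prop :=
  exists a P p, @hadamard_data r Ls a P p.

Definition strong_hadamard_set r (Ls : r.-tuple linear_forms) : Prop :=
  exists a P p, @hadamard_data r Ls a P p /\
    forall i, \sum_(j < n.+1) a 0 j * p i 0 j = 0.

End HadamardSets.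

Definition inv_coef_matrix (K : fieldType) m n (A : 'M[K]_(m, n)) : 'M[K]_(m, n) :=
  \matrix_(i, j) (A i j)^-1.

(* Main.v *)
Require Import Defs.
From HB Require Import structures.
From mathcomp Require Import all_boot all_order all_algebra.
From mathcomp Require Import reals complex.
From mathcomp Require Import ring.

(** If L_i = c_i * sum_j (a_j / p_j(i)) x_j, then sum_j a_j p_j(i) is
    sum_j a_j^2 / a_j(i) up to the factor c_i: the kernel vector of condition (2)
    is the vector of squares a_j^2, and conversely one takes square roots.
    General linearity enters only through the fact that the coefficient matrix
    of the forms has full column rank: no coordinate of the forms vanishes
    identically, so that every a_j is nonzero, and, for n = 2, a kernel vector
    of M with a zero coordinate would give a linear relation between two
    columns of the coefficient matrix. *)

Set Implicit Arguments.
Unset Strict Implicit.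
Unset Printing Implicit Defensive.

Import GRing.Theory Num.Theory.
Local Open Scope ring_scope.

Section Lines.
Variables (K : fieldType) (V : vectType K).

Lemma same_class_scale (u v : V) :
  same_class u v -> exists2 c : K, c != 0 & u = c *: v.
Proof.
case=> Q [[u0 Qu] [_ Qv]].
have /vlineP[c uE] : u \in <[v]>%VS by rewrite -Qv Qu memv_line.
exists c => //; apply: contraNneq u0 => c0.
by rewrite uE c0 scale0r.
Qed.

Lemma exists_class (v : V) : v != 0 -> exists Q : proj_space V, is_class Q v.
Proof.
move=> v0; have dim_v : \dim <[v]>%VS == 1 by rewrite dim_vline v0.
by exists (ProjPoint dim_v).
Qed.

End Lines.

Section LinearForms.
Variables (K : fieldType) (n : nat).

Lemma lform_is_linear : linear (@lform K n).
Proof.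
move=> c a b; apply/val_inj.
rewrite /= scaler_sumr -big_split /=; apply: eq_bigr => j _.
by rewrite !mxE scalerDl scalerA.
Qed.

HB.instance Definition _ :=
  GRing.isLinear.Build K 'rV[K]_n.+1 (linear_forms K n) _ _ lform_is_linear.

Lemma lform0 : lform 0 = 0 :> linear_forms K n.
Proof. exact: linear0. Qed.

Lemma lform_inj : injective (@lform K n).
Proof.
move=> a b eq_ab; apply/rowP => k.
have coefE (c : 'rV[K]_n.+1) :
    (\sum_(j < n.+1) c 0 j *: ('X_j : {mpoly K[n.+1]}))@_(U_(k))%MM = c 0 k.
  rewrite raddf_sum (bigD1 k) //= mcoeffZ mcoeffXU eqxx mulr1 big1 ?addr0 // => j jk.
  by rewrite mcoeffZ mcoeffXU (negPf jk) mulr0.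
by rewrite -[LHS]coefE -[RHS]coefE; congr (_@_ _); exact: (congr1 val eq_ab).
Qed.

(** The first [n.+1] forms are distinct because [Ls] is duplicate-free, hence they are free; their
    rows form an invertible square block of [A], which already forces [v = 0]. *)
Lemma generally_linear_col_inj r (Ls : r.-tuple (linear_forms K n))
    (A : 'M[K]_(r, n.+1)) :
  uniq Ls -> (forall i, tnth Ls i = lform (row i A)) -> generally_linear Ls ->
  forall v : 'cV[K]_n.+1, A *m v = 0 -> v = 0.
Proof.
move=> Ls_uniq Ls_coef [le_nr Ls_free] v Av0.
pose f := widen_ord le_nr.
pose F : n.+1.-tuple (linear_forms K n) := [tuple tnth Ls (f i) | i < n.+1].
have F_free : free F.
  apply: Ls_free => [|_ /tnthP[i ->]]; last by rewrite tnth_mktuple mem_tnth.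
  rewrite map_inj_uniq ?enum_uniq // => i j.
  by move/(tuple_uniqP _ Ls_uniq)/(congr1 val) => ij; apply: val_inj.
have B_unit : rowsub f A \in unitmx.
  rewrite -row_free_unit -kermx_eq0; apply/eqP/row_matrixP => k.
  rewrite row0; set u := row k _.
  have uB0 : u *m rowsub f A = 0 by rewrite -row_mul mulmx_ker row0.
  apply/rowP => i; rewrite [RHS]mxE.
  (* Through the linear map [lform], a row [u] killing the block becomes a linear relation among the
     forms of [F]. *)
  have /freeP/(_ (fun j => u 0 j)) uF := F_free; move: i; apply: uF.
  rewrite -[RHS]lform0 -uB0 mulmx_sum_row linear_sum.
  apply: eq_bigr => j _.
  by rewrite -tnth_nth tnth_mktuple Ls_coef linearZ row_rowsub.
by rewrite -(mulKmx B_unit v) mul_rowsub_mx Av0 linear0 mulmx0.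
Qed.

End LinearForms.

Section StrongHadamardSets.
Variables (K : fieldType) (n r : nat).
Variables (Ls : r.-tuple (linear_forms K n)) (A : 'M[K]_(r, n.+1)).
Hypothesis Ls_coef : forall i, tnth Ls i = lform (row i A).

Lemma strong_hadamard_set_kernel :
  (forall v : 'cV[K]_n.+1, A *m v = 0 -> v = 0) -> strong_hadamard_set Ls ->
  (forall i j, A i j != 0) /\
  exists a : 'cV[K]_n.+1,
    (forall j, a j 0 != 0) /\ inv_coef_matrix A *m a = 0.
Proof.
move=> A_inj [a [P [p [data ap0]]]].
have p_neq0 i j : p i 0 j != 0.
  have [PnD Pp _] := data i.
  by apply/eqP => pij0; apply: PnD; exists (p i); split=> //; exists j.
have AE i : exists2 c, c != 0 & forall j, A i j = c * (a 0 j / p i 0 j).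
  have [_ _ /same_class_scale[c c0]] := data i.
  rewrite Ls_coef -linearZ => /lform_inj /rowP rowE.
  by exists c => // j; have := rowE j; rewrite !mxE.
have a_neq0 j : a 0 j != 0.
  (* If [a_j = 0], column [j] of [A] vanishes and the [j]-th basis vector lies in its kernel. *)
  apply/eqP => aj0.
  have /A_inj d0 : A *m (delta_mx j 0 : 'cV_n.+1) = 0.
    rewrite -colE; apply/colP => i; rewrite !mxE.
    by have [c _ ->] := AE i; rewrite aj0 mul0r mulr0.
  by have /colP/(_ j)/eqP := d0; rewrite !mxE !eqxx oner_eq0.
split=> [i j|].
  by have [c c0 ->] := AE i; rewrite !mulf_neq0 ?invr_eq0.
exists (\col_j (a 0 j ^+ 2)); split=> [j|]; first by rewrite mxE expf_neq0.
apply/colP => i; rewrite !mxE; have [c c0 AiE] := AE i.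
(* Since [A_ij = c a_j / p_j(i)], each term satisfies [a_j^2 / A_ij = c^-1 a_j p_j(i)]. *)
transitivity (c^-1 * \sum_j a 0 j * p i 0 j); last by rewrite ap0 mulr0.
rewrite mulr_sumr; apply: eq_bigr => j _; rewrite !mxE AiE.
by field; rewrite c0 a_neq0 p_neq0.
Qed.

(** Taking the square roots [b] as given keeps this valid over any field. The points
    [p_j(i) = b_j / A_ij] give [b_j / p_j(i) = A_ij], so the forms are recovered exactly, with no
    scalar factor. *)
Lemma kernel_strong_hadamard_set (b : 'rV[K]_n.+1) :
  (forall i j, A i j != 0) -> (forall j, b 0 j != 0) ->
  inv_coef_matrix A *m (\col_j (b 0 j ^+ 2)) = 0 -> strong_hadamard_set Ls.
Proof.
move=> A_neq0 b_neq0 Mb0.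
pose p i : 'rV[K]_n.+1 := \row_j (b 0 j / A i j).
have p_neq0 i j : p i 0 j != 0 by rewrite mxE mulf_neq0 ?invr_eq0.
have row_neq0 m (v : 'rV[K]_m.+1) : (forall j, v 0 j != 0) -> v != 0.
  by move=> v0; apply: contraNneq (v0 ord0) => ->; rewrite mxE.
have p_class i : exists Q : pn K n, is_class Q (p i).
  exact/exists_class/row_neq0.
have [P Pp] := fin_all_exists p_class.
exists b, P, p; split=> i; last first.
  have /colP/(_ i) := Mb0; rewrite !mxE => Mb0i; rewrite -[RHS]Mb0i.
  by apply: eq_bigr => j _; rewrite !mxE; ring.
split=> //.
  (* A zero coordinate would persist under rescaling, so it cannot occur in any representative [q]
     of [P i]. *)
  case=> q [Qq [j qj0]].
  have /same_class_scale[c _ /rowP/(_ j)] : same_class (p i) q by exists (P i).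
  by rewrite [RHS]mxE qj0 mulr0 => /eqP; rewrite (negPf (p_neq0 i j)).
have -> : \row_j (b 0 j / p i 0 j) = row i A.
  by apply/rowP => j; rewrite !mxE invf_div mulrCA divff ?mulr1.
rewrite Ls_coef.
(* Both forms now coincide; it remains to see that their class is defined, that is, that row [i] of
   [A] is nonzero. *)
have [|Q Qc] := @exists_class _ (linear_forms K n) (lform (row i A)); last by exists Q.
rewrite -(@lform0 K n) (inj_eq (@lform_inj K n)).
by apply: row_neq0 => j; rewrite mxE.
Qed.

End StrongHadamardSets.

Section RankCriterion.
Variable K : fieldType.

Lemma rank_lt_kernelP m n (M : 'M[K]_(m, n)) :
  (\rank M < n)%N <-> exists2 a : 'cV[K]_n, a != 0 & M *m a = 0.
Proof.
have rankE : (\rank M < n)%N = (kermx M^T != 0).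
  by rewrite kermx_eq0 /row_free mxrank_tr ltn_neqAle rank_leq_col andbT.
rewrite rankE; split=> [/rowV0Pn[v /sub_kermxP vM0 v0]|[a a0 Ma0]].
  exists v^T; first by rewrite trmx_eq0.
  by rewrite -[M]trmxK -trmx_mul vM0 trmx0.
apply/rowV0Pn; exists a^T; last by rewrite trmx_eq0.
by apply/sub_kermxP; rewrite -trmx_mul Ma0 trmx0.
Qed.

(* With a_k = 0 and {k, s, t} = {0, 1, 2}, the relation
   a_s / A_is + a_t / A_it = 0 reads a_t A_is + a_s A_it = 0. *)
Lemma inv_coef_matrix_kernel_neq0 r (A : 'M[K]_(r, 3)) (a : 'cV[K]_3) :
  (forall v : 'cV[K]_3, A *m v = 0 -> v = 0) -> (forall i j, A i j != 0) ->
  a != 0 -> inv_coef_matrix A *m a = 0 -> forall j, a j 0 != 0.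
Proof.
move=> A_inj A_neq0 a_neq0 Ma0 k; apply: contraNneq a_neq0 => ak0.
pose s := lift k ord0; pose t := lift k (lift ord0 ord0).
have sum3 (F : 'I_3 -> K) : \sum_j F j = F k + (F s + F t).
  by rewrite (bigD1_ord k) //= !big_ord_recl big_ord0 addr0.
have st : s == t = false by rewrite (inj_eq lift_inj).
pose w : 'cV_3 := a t 0 *: delta_mx s 0 + a s 0 *: delta_mx t 0.
have /A_inj w0 : A *m w = 0.
  rewrite mulmxDr -!scalemxAr -!colE; apply/colP => i.
  have /colP/(_ i) := Ma0; rewrite !mxE sum3 !mxE ak0 mulr0 add0r => rel.
  (* Multiplying the relation by [A_is A_it] clears the denominators. *)
  rewrite -[RHS](mulr0 (A i s * A i t)) -rel.
  by field; rewrite !A_neq0.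
have as0 : a s 0 = 0.
  by have /colP/(_ t) := w0; rewrite !mxE !eqxx eq_sym st mulr0 mulr1 add0r.
have at0 : a t 0 = 0.
  by have /colP/(_ s) := w0; rewrite !mxE !eqxx st mulr0 mulr1 addr0.
apply/eqP/colP => j; rewrite mxE.
case: (unliftP k j) => [i|] -> //.
by case: (unliftP ord0 i) => [m|] -> //; rewrite [m]ord1.
Qed.

End RankCriterion.

Theorem theorem3p1 (R : realType) (n r : nat) (n_ge1 : (1 <= n)%N)
    (Ls : r.-tuple (linear_forms R[i] n)) (A : 'M[R[i]]_(r, n.+1))
    (Ls_uniq : uniq Ls)
    (Ls_coef : forall i : 'I_r, tnth Ls i = lform (row i A))
    (Ls_gl : generally_linear Ls) :
  let cond1 := forall (i : 'I_r) (j : 'I_n.+1), A i j != 0 in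
  let M := inv_coef_matrix A in
  let cond2 := exists a : 'cV[R[i]]_n.+1,
    (forall j : 'I_n.+1, a j 0 != 0) /\ M *m a = 0 in
  (strong_hadamard_set Ls <-> cond1 /\ cond2) /\
  (n = 2%N -> cond1 -> (cond2 <-> (\rank M <= 2)%N)).
Proof.
move=> cond1 M cond2.
have A_inj := generally_linear_col_inj Ls_uniq Ls_coef Ls_gl.
split; first split.
- exact: strong_hadamard_set_kernel.
- case=> A_neq0 [a [a_neq0 Ma0]].
  (* Only here does the base field matter: the kernel vector needs coordinatewise square roots. *)
  apply: (@kernel_strong_hadamard_set _ _ _ _ _ Ls_coef (\row_j sqrtC (a j 0))) => //.
    by move=> j; rewrite mxE sqrtC_eq0.
  rewrite -[RHS]Ma0; congr (_ *m _).
  by apply/colP => j; rewrite !mxE sqrtCK.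
move=> n2 A_neq0; subst n; split=> [[a [a_neq0 Ma0]]|].
  (* [M] has three columns, so rank at most 2 means a nontrivial kernel. *)
  rewrite -ltnS; apply/rank_lt_kernelP; exists a => //.
  by apply: contraNneq (a_neq0 0) => ->; rewrite mxE.
rewrite -ltnS => /rank_lt_kernelP[a a_neq0 Ma0]; exists a; split=> //.
exact: inv_coef_matrix_kernel_neq0 Ma0.
Qed.
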